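(* Consider the initial value problem (P) for a $p$-dimensional system of functional differential equations of order $n$ on $[0,T^*]$ described in the context, and assume: (i) the functions $f_j$, $j=1,\dots,p$, are analytic in $[0,T^*]\times\mathbb{R}^{np}\times\mathbb{R}^{\omega p}$; (ii) the problem (P) has a unique solution $\mathbf{u}$ on the interval $[0,T^*]$. Let $0<\gamma\le T^*$, $J=[0,\gamma]$, let $\mathbf{u}$ be analytic on $J$, let $\mathbf{U}(k)=\frac{1}{k!}\mathbf{u}^{(k)}(0)$ be the components of the differential transformation of $\mathbf{u}$ at $t_0=0$, and put $\mathbf{F}_k(t)=\mathbf{U}(k)t^k$ for $k\ge 0$. If there exist a constant $\delta$ with $0<\delta<1$ and $k_0\in\mathbb{N}$ such that $\|\mathbf{F}_{k+1}\|\le\delta\|\mathbf{F}_k\|$ for all $k\ge k_0$, where $\|\cdot\|$ is the norm of $C^n(J)$ given in the context, then the series $\sum_{k=0}^{\infty}\mathbf{F}_k(t)$ converges (in $C^n(J)$) to the unique solution $\mathbf{u}$ of (P) on the interval $J=[0,\gamma]$.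
   Context: Setting. Let $n,p,r\in\mathbb{N}$ and let $m_1,\dots,m_r$ be nonnegative integers with $m_i\le n$. Consider the system $$\mathbf{u}^{(n)}(t)=\mathbf{f}\bigl(t,\mathbf{u}(t),\mathbf{u}'(t),\dots,\mathbf{u}^{(n-1)}(t),\mathbf{u}_1(\alpha_1(t)),\dots,\mathbf{u}_r(\alpha_r(t))\bigr),$$ where $\mathbf{u}=(u_1,\dots,u_p)^T$ is the unknown, $\mathbf{f}=(f_1,\dots,f_p)^T$, $\mathbf{u}_i(\alpha_i(t))=(\mathbf{u}(\alpha_i(t)),\mathbf{u}'(\alpha_i(t)),\dots,\mathbf{u}^{(m_i)}(\alpha_i(t)))$ for $i=1,\dots,r$, and $f_j:[0,\infty)\times\mathbb{R}^{np}\times\mathbb{R}^{\omega p}\to\mathbb{R}$ are continuous, with $\omega=\sum_{i=1}^r(m_i+1)$. Each delayed argument $\alpha_i$ is of one of three types: (1) $\alpha_i(t)=q_it$ with $q_i\in(0,1)$; (2) $\alpha_i(t)=t-\tau_i$ with a real constant $\tau_i>0$; (3) $\alpha_i(t)=t-\tau_i(t)$ with a real function $\tau_i$ satisfying $\tau_i(t)\ge\tau_{i0}>0$ for $t>0$. Let $t^*=\min_{1\le i\le r}\{\inf_{t>0}\alpha_i(t)\}\le 0$. The initial conditions are $\mathbf{u}(0)=\mathbf{v}_0,\ \mathbf{u}'(0)=\mathbf{v}_1,\dots,\mathbf{u}^{(n-1)}(0)=\mathbf{v}_{n-1}$ with given vectors $\mathbf{v}_k\in\mathbb{R}^p$. If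 $t^*<0$, there is also given an initial vector function $\Phi=(\phi_1,\dots,\phi_p)^T$ on $[t^*,0]$ with $\phi_j\in C^n([t^*,0],\mathbb{R})$, satisfying $\Phi(0)=\mathbf{u}(0),\dots,\Phi^{(n-1)}(0)=\mathbf{u}^{(n-1)}(0)$, and one requires $\mathbf{u}=\Phi$ on $[t^*,0]$ (so $\mathbf{u}$ and its derivatives at negative arguments $\alpha_i(t)$ are those of $\Phi$). This is problem (P); $T^*>0$ denotes the right endpoint of the interval on which it is considered. Differential transformation. For an analytic function $\mathbf{u}$, the $k$th component of its differential transformation at $0$ is $\mathbf{U}(k)=\frac{1}{k!}\mathbf{u}^{(k)}(0)\in\mathbb{R}^p$. Here analyticity on $J=[0,\gamma]$ and derivatives at $0$ refer to the restriction of the solution $\mathbf{u}$ to $J$ (one-sided at the endpoints). Norm. $C^n(J)$ is the Banach space of vector-valued functions $\mathbf{h}=(h_1,\dots,h_p)^T$ on $J$ with continuous derivatives up to order $n$, with norm $\|\mathbf{h}\|=\max_{i=1,\dots,p}\max_{j=0,\dots,n}\max_{t\in J}|h_i^{(j)}(t)|$. *)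

(* Defs.v *)
From HB Require Import structures.
From mathcomp Require Import all_boot all_order all_algebra.
From mathcomp Require Import all_classical all_reals all_analysis.

Set Implicit Arguments.
Unset Strict Implicit.
Unset Printing Implicit Defensive.

Import Order.TTheory GRing.Theory Num.Theory.
Import numFieldNormedType.Exports.

Local Open Scope classical_set_scope.
Local Open Scope ring_scope.

(* Derivatives are taken within a set D: two-sided in the interior of an
   interval D, one-sided at its endpoints.  When the limit does not exist,
   derive_in is unspecified, hence the separate predicate derivable_in. *)
Definition diff_quot (R : realType) (g : R -> R) (x y : R) : R :=
  (y - x)^-1 * (g y - g x).

Definition derivable_in (R : realType) (D : set R) (g : R -> R) (x : R) : Prop :=
  cvg (diff_quot g x y @[y --> within D x^']).

Definition derive_in (R : realType) (D : set R) (g : R -> R) (x : R) : R :=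
  lim (diff_quot g x y @[y --> within D x^']).

Definition nderive_in (R : realType) (D : set R) (k : nat) (g : R -> R) : R -> R :=
  iter k (derive_in D) g.

Definition component (R : realType) (p : nat) (h : R -> 'cV[R]_p) (j : 'I_p) : R -> R :=
  fun t => h t j 0.

Definition vderive_in (R : realType) (p : nat) (D : set R) (k : nat)
    (h : R -> 'cV[R]_p) (t : R) : 'cV[R]_p :=
  \col_(j < p) nderive_in D k (component h j) t.

Definition n_derivable_in (R : realType) (p : nat) (D : set R) (n : nat)
    (h : R -> 'cV[R]_p) : Prop :=
  forall (j : 'I_p) (k : nat), (k < n)%N ->
    forall t, D t -> derivable_in D (nderive_in D k (component h j)) t.

Definition is_Cn (R : realType) (p : nat) (D : set R) (n : nat)
    (h : R -> 'cV[R]_p) : Prop :=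
  n_derivable_in D n h /\
  forall (j : 'I_p) (k : nat), (k <= n)%N ->
    {within D, continuous (nderive_in D k (component h j))}.

Definition Cn_norm (R : realType) (p : nat) (D : set R) (n : nat)
    (h : R -> 'cV[R]_p) : R :=
  \big[Num.max/0]_(i < p) \big[Num.max/0]_(j < n.+1)
    sup [set `|nderive_in D j (component h i) t| | t in D].

(* The membership clauses ensure that the suprema in Cn_norm, taken over a
   compact D, are genuine maxima. *)
Definition Cn_series_cvg (R : realType) (p : nat) (D : set R) (n : nat)
    (F : nat -> R -> 'cV[R]_p) (u : R -> 'cV[R]_p) : Prop :=
  [/\ forall k, is_Cn D n (F k),
      is_Cn D n u &
      Cn_norm D n (fun t => \sum_(k < N) F k t - u t) @[N --> \oo] --> (0 : R)].

(* Real analyticity relative to a set: near each point of the set, the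
   restriction to the set is the sum of a power series centred there. *)
Definition analytic_on (R : realType) (D : set R) (g : R -> R) : Prop :=
  forall x, D x -> exists (c : nat -> R) (rho : R), 0 < rho /\
    forall y, D y -> `|y - x| < rho ->
      pseries c (y - x) @ \oo --> g y.

(* Sum of the terms of a d-variable power series whose exponents are all < N. *)
Definition box_sum (R : realType) (d : nat) (c : ('I_d -> nat) -> R)
    (h : 'I_d -> R) (N : nat) : R :=
  \sum_(a : {ffun 'I_d -> 'I_N}) c (fun i => a i) * \prod_(i < d) h i ^+ a i.

(* The multiple series is required to converge absolutely, so that its sum does
   not depend on the order of summation. *)
Definition multi_analytic_on (R : realType) (d : nat) (S : set 'rV[R]_d)
    (g : 'rV[R]_d -> R) : Prop :=
  forall x, S x -> exists (c : ('I_d -> nat) -> R) (rho : R), 0 < rho /\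
    forall y, S y -> (forall i, `|y 0 i - x 0 i| < rho) ->
      (exists M, forall N,
         box_sum (fun a => `|c a|) (fun i => `|y 0 i - x 0 i|) N <= M) /\
      box_sum c (fun i => y 0 i - x 0 i) N @[N --> \oo] --> g y.

Definition is_delay (R : realType) (a : R -> R) : Prop :=
  [\/ exists q : R, 0 < q < 1 /\ forall t, 0 <= t -> a t = q * t,
      exists tau : R, 0 < tau /\ forall t, 0 <= t -> a t = t - tau |
      exists (tau : R -> R) (tau0 : R),
        [/\ 0 < tau0, forall t, 0 < t -> tau0 <= tau t &
            forall t, 0 <= t -> a t = t - tau t]].

(* Extended-real valued: -oo when some delayed argument is unbounded below. *)
Definition tstar (R : realType) (r : nat) (alpha : 'I_r -> R -> R) : \bar R :=
  \big[Order.min/+oo%E]_(i < r)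
    ereal_inf [set (alpha i t)%:E | t in [set t | 0 < t]].

Definition past (R : realType) (r : nat) (alpha : 'I_r -> R -> R) : set R :=
  [set t | (tstar alpha <= t%:E)%E /\ t <= 0].

Definition omega (r : nat) (m : 'I_r -> nat) : nat := (\sum_(i < r) (m i).+1)%N.

(* R x R^(np) x R^(omega p), with the first coordinate standing for t. *)
Definition argdim (n p r : nat) (m : 'I_r -> nat) : nat :=
  (1 + (n * p + omega m * p))%N.

Definition time_coord (R : realType) (n p r : nat) (m : 'I_r -> nat)
    (x : 'rV[R]_(argdim n p m)) : R := (lsubmx x) 0 0.

(* u^(l)(s) for s = alpha_i(t): taken from Phi at negative arguments, and from u
   (restricted to [0, T]) at nonnegative ones. *)
Definition delayed (R : realType) (p r : nat) (alpha : 'I_r -> R -> R)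
    (Phi : R -> 'cV[R]_p) (T : R) (u : R -> 'cV[R]_p) (l : nat) (s : R) :
    'cV[R]_p :=
  if s < 0 then vderive_in (past alpha) l Phi s else vderive_in `[0, T] l u s.

(* (t, u(t), ..., u^(n-1)(t), u_1(alpha_1(t)), ..., u_r(alpha_r(t))) as one
   vector; mxvec lists the entries row by row, each row being one derivative. *)
Definition rhs_arg (R : realType) (n p r : nat) (m : 'I_r -> nat)
    (alpha : 'I_r -> R -> R) (Phi : R -> 'cV[R]_p) (T : R)
    (u : R -> 'cV[R]_p) (t : R) : 'rV[R]_(argdim n p m) :=
  row_mx (t%:M : 'rV[R]_1)
    (row_mx
      (mxvec (\matrix_(k < n, j < p) vderive_in `[0, T] k u t j 0))
      (mxvec (\mxcol_(i < r)
        \matrix_(l < (m i).+1, j < p)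
          delayed alpha Phi T u l (alpha i t) j 0))).

(* Solutions of u^(n)(t) = f(t, u(t), ..., u_1(alpha_1(t)), ...) on [0, T] with
   initial values v and, if tstar < 0, initial function Phi.  For delays as in
   is_delay, the premise of the last clause holds for every t > 0; it matters
   only at t = 0, where a delay of the third type is not constrained and
   alpha_i(0) may leave the domain of the data. *)
Definition is_solution (R : realType) (n p r : nat) (m : 'I_r -> nat)
    (f : 'rV[R]_(argdim n p m) -> 'cV[R]_p) (alpha : 'I_r -> R -> R)
    (v : 'I_n -> 'cV[R]_p) (Phi : R -> 'cV[R]_p) (T : R)
    (u : R -> 'cV[R]_p) : Prop :=
  [/\ n_derivable_in `[0, T] n u,
      forall k : 'I_n, vderive_in `[0, T] k u 0 = v k,
      ((tstar alpha < 0)%E -> forall t, past alpha t -> u t = Phi t) &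
      forall t : R, 0 <= t <= T ->
        (forall i, (tstar alpha <= (alpha i t)%:E)%E /\ alpha i t <= T) ->
        vderive_in `[0, T] n u t = f (rhs_arg n m alpha Phi T u t)].

(* U(k) = u^(k)(0) / k!, with u restricted to J. *)
Definition dtm (R : realType) (p : nat) (J : set R) (u : R -> 'cV[R]_p)
    (k : nat) : 'cV[R]_p := (k`!%:R)^-1 *: vderive_in J k u 0.

Definition dtm_term (R : realType) (p : nat) (J : set R) (u : R -> 'cV[R]_p)
    (k : nat) (t : R) : 'cV[R]_p := t ^+ k *: dtm J u k.

(* Main.v *)
(** The norm of [F_k] in [C^n(J)] dominates [|U(k)| gamma^k], so the ratio
    condition makes [|U(k)| gamma^k] decay like [delta^k]; the power series with
    coefficients [U(k)] therefore converges on a disc of radius larger than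
    [gamma].  Its sum has the same derivatives at 0 as the analytic function
    [u], hence equals [u] on [J] by the identity theorem.  The norm of a
    remainder is then at most a tail of the geometric series, because the term
    of degree [k] of its [l]-th derivative is largest at [t = gamma], where it
    is bounded by the norm of [F_(k+l)]. *)

Require Import Defs.
From HB Require Import structures.
From mathcomp Require Import all_boot all_order all_algebra.
From mathcomp Require Import all_classical all_reals all_analysis.
From mathcomp Require Import ring lra.
Import Order.TTheory GRing.Theory Num.Theory.
Import numFieldNormedType.Exports.
Local Open Scope classical_set_scope.
Local Open Scope ring_scope.

(** * Power series inside their disc of convergence: term-by-term differentiation *)

Lemma mulSn_expr_le {R : realDomainType} {a w : R} (k : nat) :
  0 <= a <= w -> k.+1%:R * a ^+ k * (w - a) <= w ^+ k.+1.
Proof.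
move=> /andP[a0 aw]; have w0 := le_trans a0 aw.
elim: k => [|k IH]; first by rewrite expr0 expr1 !mulr1 mul1r; lra.
have -> : k.+2%:R * a ^+ k.+1 * (w - a)
    = a * (k.+1%:R * a ^+ k * (w - a)) + a ^+ k.+1 * (w - a).
  by rewrite -(natr1 k.+1) exprS; ring.
have -> : w ^+ k.+2 = a * w ^+ k.+1 + w ^+ k.+1 * (w - a).
  by rewrite (exprS w k.+1); ring.
apply: lerD; first exact: ler_wpM2l.
by apply: ler_wpM2r; [rewrite subr_ge0|apply: lerXn2r].
Qed.

Lemma exists_between {R : realFieldType} {x y : R} :
  x < y -> exists w, x < w < y.
Proof. by move=> xy; exists ((x + y) / 2); lra. Qed.

(** With [|z| < w < rho], [mulSn_expr_le] bounds the [n]-th term of the derived series at [z] by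
    [(w - |z|)^-1] times the term of degree [n.+1] of the absolute series at [w]. *)
Lemma is_cvg_pseries_diffs {R : realType} {c : R^nat} {rho : R} :
  (forall z, `|z| < rho -> cvgn (pseries c z)) ->
  forall z, `|z| < rho -> cvgn (pseries (pseries_diffs c) z).
Proof.
move=> cc z zrho.
have [w /andP[zw wr]] := exists_between zrho.
(* Convergence at the further point [w'] gives absolute convergence at [w]. *)
have [w' /andP[ww' w'r]] := exists_between wr.
have w0 : 0 < w by exact: le_lt_trans zw.
have w'0 : 0 < w' by exact: lt_trans ww'.
have wz : 0 < w - `|z| by rewrite subr_gt0.
have cw : cvgn (pseries (fun i => `|c i|) w).
  apply: (@is_cvg_pseries_inside_norm _ _ w'); last by rewrite !gtr0_norm.
  by apply: cc; rewrite gtr0_norm.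
apply: normed_cvg.
pose v := fun i => (w - `|z|)^-1 * (`|c i| * w ^+ i).
have cv : cvgn (series v) by apply: is_cvg_seriesZ.
(* [pseries_diffs c n] involves [c n.+1], so the dominating series is [v] shifted by one. *)
have cvS : cvgn (series (fun i => v i.+1)).
  have -> : series (fun i => v i.+1) = (fun n => series v n.+1 - v 0%N).
    apply/funext => n; rewrite /series /= !big_mkord big_ord_recl.
    by rewrite addrAC subrr add0r.
  apply: is_cvgB; last exact: is_cvg_cst.
  by apply/cvg_ex; case/cvg_ex: cv => l vl; exists l; rewrite (cvg_shiftS (series v)).
apply: series_le_cvg cvS => [n /=|n /=|n /=]; first exact: normr_ge0.
  by rewrite /v !mulr_ge0// ?invr_ge0 ?exprn_ge0 ?(ltW wz) ?(ltW w0).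
rewrite /v /pseries_diffs !normrM normrX normr_nat.
rewrite mulrC -ler_pdivrMl ?invr_gt0// invrK.
have /(ler_wpM2l (normr_ge0 (c n.+1))) : n.+1%:R * `|z| ^+ n * (w - `|z|) <= w ^+ n.+1.
  by apply: mulSn_expr_le; rewrite normr_ge0 ltW.
by apply: le_trans; rewrite le_eqVlt; apply/orP; left; apply/eqP; ring.
Qed.

(** Makes limits along [within D x^'] unique, so that [derive_in], defined by [lim], equals any
    limit exhibited for it. *)
Lemma limit_point_within_dnbhs {R : realType} {D : set R} (x : R) :
  limit_point D x -> ProperFilter (within D x^').
Proof.
move=> Dx; apply: Build_ProperFilter_ex => P.
rewrite /within /= /dnbhs /within /= => /Dx [y [yx Dy]]; rewrite /= => h.
by exists y; apply: h => //; apply/eqP.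
Qed.

(** [pseries_snd_diffs] asks for convergence of the series and of its first two derived series at a
    point beyond [|z|], here [w]. *)
Lemma is_derive_pseries {R : realType} {c : R^nat} {rho : R} :
  (forall z, `|z| < rho -> cvgn (pseries c z)) ->
  forall z : R, `|z| < rho ->
    is_derive z (1 : R) (fun t => limn (pseries c t)) (limn (pseries (pseries_diffs c) z)).
Proof.
move=> cc z zrho; have [w /andP[zw wrho]] := exists_between zrho.
have w0 : 0 < w by exact: le_lt_trans zw.
have cd := is_cvg_pseries_diffs cc; have cdd := is_cvg_pseries_diffs cd.
have wr : `|w| < rho by rewrite gtr0_norm.
have zw' : `|z| < `|w| by rewrite (gtr0_norm w0).
exact: pseries_snd_diffs (cc _ wr) (cd _ wr) (cdd _ wr) zw'.
Qed.

Lemma continuous_pseries {R : realType} {c : R^nat} {rho : R} :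
  (forall z, `|z| < rho -> cvgn (pseries c z)) ->
  forall z : R, `|z| < rho -> {for z, continuous (fun t => limn (pseries c t))}.
Proof.
move=> cc z zrho; have [d _] := is_derive_pseries cc z zrho.
by apply: differentiable_continuous; apply/derivable1_diffP.
Qed.

(** * Derivatives within a set of a function given there by a power series *)

Lemma cvg_diff_quot_pseries {R : realType} {D : set R} {c : R^nat} {x rho : R}
    (g : R -> R) :
  (forall z, `|z| < rho -> cvgn (pseries c z)) ->
  (forall y, D y -> `|y - x| < rho -> g y = limn (pseries c (y - x))) ->
  forall y, D y -> `|y - x| < rho ->
    diff_quot g y z @[z --> within D y^'] --> limn (pseries (pseries_diffs c) (y - x)).
Proof.
move=> cc gE y Dy yx.
have [df dfE] := is_derive_pseries cc _ yx.
set f := (fun t => limn (pseries c t)) in df dfE.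
rewrite -dfE.
have H : h^-1 *: (f (h *: 1 + (y - x)) - f (y - x)) @[h --> 0^'] --> 'D_1 f (y - x).
  exact: df.
(* Translation carries [within D y^'] into [0^'], so the two-sided limit for the sum restricts to
   [D]. *)
have Hy : (z - y) @[z --> within D y^'] --> 0^'.
  move=> A /nbhs_ballP[e /= e0 he]; apply/nbhs_ballP; exists e => //= z.
  rewrite /ball /= => yz zy Dz.
  by apply: he; rewrite /ball /= ?subr_eq0// sub0r normrN distrC.
have := cvg_comp _ _ Hy H; apply: cvg_trans; apply: near_eq_cvg.
(* With this radius [z] stays in the disc around [x] where [g] is the sum. *)
apply/nbhs_ballP; exists (rho - `|y - x|); first by rewrite /= subr_gt0.
move=> z; rewrite /ball /= => yz zy Dz.
have zx : `|z - x| < rho.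
  rewrite (_ : z - x = (y - x) - (y - z)); last by ring.
  by apply: le_lt_trans (ler_normB _ _) _; rewrite addrC -ltrBrDr.
rewrite /diff_quot (gE _ Dy yx) (gE _ Dz zx) /f /GRing.scale /= mulr1.
by congr (_ * (limn (pseries c _) - _)); ring.
Qed.

(** Induction on [k]: the formula holds at all points of [D] in the disc, so the [k]-th derivative
    is again a power series there and [cvg_diff_quot_pseries] applies to it. *)
Lemma nderive_in_pseries {R : realType} {D : set R} {x rho : R} :
  (forall y, D y -> limit_point D y) ->
  forall (c : R^nat) (g : R -> R),
  (forall z, `|z| < rho -> cvgn (pseries c z)) ->
  (forall y, D y -> `|y - x| < rho -> g y = limn (pseries c (y - x))) ->
  forall k y, D y -> `|y - x| < rho ->
    [/\ nderive_in D k g y = limn (pseries (iter k (@pseries_diffs R) c) (y - x)),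
        derivable_in D (nderive_in D k g) y &
        nderive_in D k g z @[z --> within D (nbhs y)] --> nderive_in D k g y].
Proof.
move=> limD c g cc gE k.
have ck : forall z, `|z| < rho -> cvgn (pseries (iter k (@pseries_diffs R) c) z).
  by elim: k => //= k IH; exact: is_cvg_pseries_diffs.
have E : forall y, D y -> `|y - x| < rho ->
    nderive_in D k g y = limn (pseries (iter k (@pseries_diffs R) c) (y - x)).
  elim: k ck => // k IH _ y Dy yx.
  have ck : forall z, `|z| < rho -> cvgn (pseries (iter k (@pseries_diffs R) c) z).
    by elim: k {IH} => //= k IH; exact: is_cvg_pseries_diffs.
  have P := limit_point_within_dnbhs _ (limD _ Dy).
  have := cvg_diff_quot_pseries (nderive_in D k g) ck (IH ck) y Dy yx.
  by move/(cvg_lim (@Rhausdorff R)).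
move=> y Dy yx; split; first exact: E.
  by apply: cvgP; exact: cvg_diff_quot_pseries _ ck E _ Dy yx.
rewrite E //.
have Hy : (z - x) @[z --> within D (nbhs y)] --> y - x.
  by apply: cvgB; [exact: cvg_within|exact: cvg_cst].
have := cvg_comp _ _ Hy (continuous_pseries ck _ yx).
apply: cvg_trans; apply: near_eq_cvg.
apply/nbhs_ballP; exists (rho - `|y - x|); first by rewrite /= subr_gt0.
move=> z; rewrite /ball /= => yz Dz.
rewrite E // (_ : z - x = (y - x) - (y - z)); last by ring.
by apply: le_lt_trans (ler_normB _ _) _; rewrite addrC -ltrBrDr.
Qed.

Lemma iter_pseries_diffsE {R : realType} (c : R^nat) (k i : nat) :
  iter k (@pseries_diffs R) c i = ((i + k) ^_ k)%:R * c (i + k)%N.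
Proof.
elim: k i => [|k IH] i; first by rewrite addn0 ffactn0 mul1r.
rewrite /= /pseries_diffs IH mulrA -natrM addSnnS; congr (_%:R * _).
by rewrite ffactnSr -addSnnS addnK mulnC.
Qed.

Lemma pseries_at0 {R : realType} (c : R^nat) : limn (pseries c 0) = c 0%N.
Proof.
(* The partial sum of order 0 is empty; only the shifted sequence is constant. *)
apply: cvg_lim => //; rewrite -(cvg_shiftS (pseries c 0)).
rewrite (_ : (fun n => _) = cst (c 0%N)); first exact: cvg_cst.
apply/funext => n; rewrite /pseries /series /= big_mkord big_ord_recl /= expr0 mulr1.
by rewrite big1 ?addr0// => i _; rewrite expr0n mulr0.
Qed.

(** Derivatives within [D] determine the coefficients, even at an endpoint of [D]; this is how two
    expansions are identified below. *)
Lemma nderive_in_center {R : realType} {D : set R} {x rho : R} :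
  0 < rho -> D x -> (forall y, D y -> limit_point D y) ->
  forall (c : R^nat) (g : R -> R),
  (forall z, `|z| < rho -> cvgn (pseries c z)) ->
  (forall y, D y -> `|y - x| < rho -> g y = limn (pseries c (y - x))) ->
  forall k, nderive_in D k g x = k`!%:R * c k.
Proof.
move=> rho0 Dx limD c g cc gE k.
have [|-> _ _] := nderive_in_pseries limD c g cc gE k x Dx; first by rewrite subrr normr0.
by rewrite subrr pseries_at0 iter_pseries_diffsE add0n ffactnn.
Qed.

Lemma limit_point_itv {R : realType} {a b : R} : a < b ->
  forall y, [set` `[a, b]] y -> limit_point [set` `[a, b]] y.
Proof.
move=> ab y; rewrite /= in_itv /= => /andP[ay yb] U /nbhs_ballP[e /= e0 he].
have [yltb|bley] := ltP y b.
  pose h := Num.min (e / 2) (b - y).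
  have h0 : 0 < h by rewrite lt_min subr_gt0 yltb divr_gt0.
  have h1 : h <= e / 2 by rewrite ge_min lexx.
  have h2 : h <= b - y by rewrite ge_min lexx orbT.
  exists (y + h); split.
  - by apply/eqP; lra.
  - by rewrite /= in_itv /=; apply/andP; split; lra.
  - by apply: he; rewrite /ball /= opprD addrA subrr sub0r normrN gtr0_norm//; lra.
pose h := Num.min (e / 2) (y - a).
have h0 : 0 < h by rewrite lt_min subr_gt0 (lt_le_trans ab) // divr_gt0.
have h1 : h <= e / 2 by rewrite ge_min lexx.
have h2 : h <= y - a by rewrite ge_min lexx orbT.
exists (y - h); split.
- by apply/eqP; lra.
- by rewrite /= in_itv /=; apply/andP; split; lra.
- by apply: he; rewrite /ball /= opprB addrCA subrr addr0 gtr0_norm//; lra.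
Qed.

(** * Dominated series and recentring of power series *)

Lemma is_cvg_series_dominated {R : realType} {u v : R^nat} :
  (forall k, `|u k| <= v k) -> cvgn (series v) -> cvgn (series u).
Proof.
move=> uv cv; apply: normed_cvg; apply: series_le_cvg cv => [n /=|n|//].
  exact: normr_ge0.
exact: le_trans (uv n).
Qed.

(** The triangle inequality between the partial sums of orders [N] and [M >= N], passed to the limit
    in [M]. *)
Lemma series_tail_le {R : realType} {u v : R^nat} (N : nat) :
  (forall k, `|u k| <= v k) -> cvgn (series v) ->
  `|limn (series u) - series u N| <= limn (series v) - series v N.
Proof.
move=> uv cv; have cu := is_cvg_series_dominated uv cv.
have c1 : series u M - series u N @[M --> \oo] --> limn (series u) - series u N.
  by apply: cvgB => //; exact: cvg_cst.
have c2 : series v M - series v N @[M --> \oo] --> limn (series v) - series v N.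
  by apply: cvgB => //; exact: cvg_cst.
have c3 : `|series u M - series u N| @[M --> \oo] --> `|limn (series u) - series u N|.
  exact: cvg_norm.
rewrite -(cvg_lim (@Rhausdorff R) c3) -(cvg_lim (@Rhausdorff R) c2).
apply: ler_lim; [exact: cvgP c3|exact: cvgP c2|].
exists N => // M /= NM; rewrite !sub_series_geq//.
by apply: le_trans (ler_norm_sum _ _ _) _; apply: ler_sum => k _.
Qed.

Lemma sum_geometric_le {R : realFieldType} (q : R) (N : nat) :
  0 <= q < 1 -> \sum_(0 <= j < N) q ^+ j <= (1 - q)^-1.
Proof.
move=> /andP[q0 q1]; have q1' : 0 < 1 - q by lra.
rewrite -[leRHS]mul1r ler_pdivlMr//.
elim: N => [|N IH]; first by rewrite big_nil; lra.
suff -> : (\sum_(0 <= j < N.+1) q ^+ j) * (1 - q) = 1 - q ^+ N.+1.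
  by rewrite gerBl exprn_ge0.
elim: N {IH} => [|N IH]; first by rewrite big_nat1 expr0 expr1 mul1r.
by rewrite big_nat_recr //= mulrDl IH !exprS; ring.
Qed.

Lemma binomial_term_le {R : realFieldType} (x y : R) (k j : nat) :
  0 <= x -> 0 <= y -> x ^+ (k - j) * y ^+ j *+ 'C(k, j) <= (x + y) ^+ k.
Proof.
move=> x0 y0; case: (ltnP k j) => kj.
  by rewrite bin_small// mulr0n exprn_ge0// addr_ge0.
rewrite exprDn (bigD1 (Ordinal (kj : (j < k.+1)%N))) //= lerDl sumr_ge0// => i _.
by rewrite mulrn_wge0// mulr_ge0// exprn_ge0.
Qed.

(* The partial sum of order [N] at [s + x] is a polynomial in [x] whose [j]-th
   coefficient differs from its limit [d j] by at most [rho^-j] times the [N]-th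
   absolute remainder at [|s| + rho], as ['C(k, j) |s|^(k-j) rho^j] is a single
   term of [(|s| + rho)^k]; so the double sum is never rearranged. *)
Lemma pseries_recenter {R : realType} (a : R^nat) (s rho : R) :
  0 < rho -> cvgn (pseries (fun k => `|a k|) (`|s| + rho)) ->
  exists d : R^nat, forall x, `|x| < rho ->
    pseries d x @ \oo --> limn (pseries a (s + x)).
Proof.
move=> rho0 ca.
(* The coefficient of [x^j] in [a k * (s + x)^k]; for [k < j] the binomial vanishes, so the
   truncated subtraction is harmless. *)
pose t j k := a k * s ^+ (k - j) *+ 'C(k, j).
pose A k := `|a k| * (`|s| + rho) ^+ k.
have tA j k : `|t j k * rho ^+ j| <= A k.
  rewrite /t /A mulrnAl normrMn -!mulrA normrM -mulrnAr ler_wpM2l//.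
  rewrite normrM !normrX (gtr0_norm rho0).
  by apply: binomial_term_le => //; exact: ltW.
pose d j := limn (series (t j)).
have dt j N : `|d j - series (t j) N| * rho ^+ j <= limn (series A) - series A N.
  have tA' k : `|t j k| <= rho ^- j * A k.
    rewrite -ler_pdivrMl ?invr_gt0 ?exprn_gt0// invrK mulrC.
    by rewrite -[X in _ * X](@gtr0_norm _ (rho ^+ j)) ?exprn_gt0// -normrM.
  have cA' : cvgn (series (rho ^- j *: A)) by apply: is_cvg_seriesZ.
  have := series_tail_le N tA' cA'.
  rewrite lim_seriesZ// /series /= -mulr_sumr -mulrBr => h.
  by rewrite mulrC -ler_pdivlMl// exprn_gt0.
exists d => x xrho.
have cax : cvgn (pseries a (s + x)).
  apply: (@is_cvg_series_dominated _ _ A) => // k.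
  rewrite normrM normrX /A ler_wpM2l// lerXn2r ?nnegrE//.
    by rewrite addr_ge0// ltW.
  by apply: le_trans (ler_normD _ _) _; rewrite lerD2l ltW.
(* For [k < N] the degree in [x] is below [N], so both indices run over [[0, N)] and only finite
   sums are exchanged. *)
have PN N : pseries a (s + x) N = \sum_(0 <= j < N) series (t j) N * x ^+ j.
  rewrite /pseries /series /=.
  under [RHS]eq_bigr do rewrite mulr_suml.
  rewrite exchange_big /=; apply: eq_big_nat => k /andP[_ kN].
  rewrite exprDn mulr_sumr -(big_mkord xpredT (fun j => a k * (s ^+ (k - j) * x ^+ j *+ 'C(k, j)))).
  rewrite [RHS](big_cat_nat (n := k.+1)) //= [X in _ + X]big_nat_cond.
  rewrite [X in _ + X]big1 ?addr0; last first.
    by move=> j /andP[/andP[kj _] _]; rewrite /t bin_small// mulr0n mul0r.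
  by apply: eq_bigr => j _; rewrite /t mulrnAl mulrnAr mulrA.
suff H : pseries d x N - pseries a (s + x) N @[N --> \oo] --> (0 : R).
  have -> : pseries d x =
      (fun N => (pseries d x N - pseries a (s + x) N) + pseries a (s + x) N).
    by apply/funext => N; rewrite subrK.
  by rewrite -[X in _ --> X]add0r; apply: cvgD.
(* Bounds the geometric sums of ratio [|x| / rho], which arise from weighing [x^j] against the
   [rho^j] of [dt]. *)
pose K := (1 - `|x| / rho)^-1.
have bnd N : `|pseries d x N - pseries a (s + x) N| <= (limn (series A) - series A N) * K.
  rewrite PN /pseries /series /= -sumrB.
  apply: le_trans (ler_norm_sum _ _ _) _.
  apply: (@le_trans _ _ (\sum_(0 <= j < N) (limn (series A) - series A N) * (`|x| / rho) ^+ j)).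
    apply: ler_sum => j _; rewrite -mulrBl normrM expr_div_n normrX.
    rewrite [leRHS]mulrA mulrAC ler_wpM2r ?exprn_ge0//.
    by rewrite ler_pdivlMr ?exprn_gt0//; exact: dt.
  rewrite -mulr_sumr ler_wpM2l//.
    by apply: le_trans (dt 0%N N); rewrite expr0 mulr1.
  by apply: sum_geometric_le; rewrite divr_ge0 ?(ltW rho0)//= ltr_pdivrMr// mul1r.
apply/cvgr0Pnorm_lt => e e0.
have : (limn (series A) - series A N) * K @[N --> \oo] --> (0 : R).
  rewrite -(mul0r K) -(subrr (limn (series A))); apply: cvgM; last exact: cvg_cst.
  by apply: cvgB => //; exact: cvg_cst.
move=> /cvgr0Pnorm_lt/(_ e e0); apply: filterS => N h.
exact: le_lt_trans (le_trans (bnd N) (ler_norm _)) h.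
Qed.

(** * Identity theorem on [[0, gamma]] *)

Lemma analytic_on_pseries {R : realType} {D : set R} {g : R -> R} {x : R} :
  analytic_on D g -> D x -> limit_point D x ->
  exists (c : R^nat) (rho : R), [/\ 0 < rho,
    forall z, `|z| < rho -> cvgn (pseries c z) &
    forall y, D y -> `|y - x| < rho -> g y = limn (pseries c (y - x))].
Proof.
move=> ga Dx limx; have [c [rho0 [rho0_gt0 gc]]] := ga _ Dx.
(* [analytic_on] gives convergence only at differences [y - x] with [y] in [D]; one such point other
   than [x] yields the whole disc of radius [|y1 - x|]. *)
have [|y1 [y1x Dy1]] := limx (ball x rho0); first by apply: nbhsx_ballx.
rewrite /ball /= distrC => y1r.
exists c, `|y1 - x|; split.
- by rewrite normr_gt0 subr_eq0.
- move=> z zy; apply: is_cvg_pseries_inside zy.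
  by apply: cvgP; exact: gc.
- move=> y Dy yx; apply/esym/cvg_lim => //.
  by apply: gc => //; exact: lt_trans y1r.
Qed.

(** The expansion of [g] at [s] and the series recentred at [s] agree on [[0, s]], hence have the
    same left derivatives at [s], hence the same coefficients; so agreement extends to the right of
    [s]. *)
Lemma identity_at_sup {R : realType} {gamma rho s : R} {g : R -> R} {a : R^nat} :
  0 < gamma -> gamma < rho -> 0 <= s <= gamma ->
  analytic_on `[0, gamma] g ->
  (forall k, nderive_in `[0, gamma] k g 0 = k`!%:R * a k) ->
  cvgn (pseries (fun k => `|a k|) rho) ->
  (forall y, 0 <= y < s -> g y = limn (pseries a y)) ->
  exists2 r, 0 < r &
    forall y, 0 <= y <= gamma -> `|y - s| < r -> g y = limn (pseries a y).
Proof.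
move=> gamma0 grho /andP[s0 sg] ga gder ca gS.
have Ds : [set` `[0, gamma]] s by rewrite /= in_itv /= s0.
have limD := limit_point_itv gamma0.
have [c [rho1 [rho1_gt0 cc gc]]] := analytic_on_pseries ga Ds (limD _ Ds).
have caz (z : R) : `|z| < rho -> cvgn (pseries a z).
  move=> zr; apply: normed_cvg.
  rewrite (_ : [normed _] = pseries (fun k => `|a k|) `|z|).
    apply: is_cvg_pseries_inside ca _.
    by rewrite normr_id (lt_le_trans zr)// ler_norm.
  by apply/funext => n; apply: eq_bigr => k _; rewrite /= normrM normrX.
(* For [s = 0] the interval [[0, s]] degenerates, and the prescribed derivatives at 0 identify the
   coefficients. *)
have [s_eq0|s_neq0] := eqVneq s 0.
  exists rho1 => // y yg; rewrite s_eq0 subr0 => yr.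
  have -> : a = c.
    apply/funext => k; apply: (@mulfI _ k`!%:R).
      by rewrite pnatr_eq0 -lt0n fact_gt0.
    by rewrite -(nderive_in_center rho1_gt0 Ds limD c g cc gc) s_eq0 gder.
  by rewrite gc ?s_eq0 ?subr0//= in_itv.
have s_gt0 : 0 < s by rewrite lt_def s_neq0.
have rho2_gt0 : 0 < rho - s by lra.
have [d dS] : exists d : R^nat, forall x, `|x| < rho - s ->
    pseries d x @ \oo --> limn (pseries a (s + x)).
  by apply: pseries_recenter => //; rewrite ger0_norm// subrKC.
pose r := Num.min rho1 (rho - s).
have r_gt0 : 0 < r by rewrite lt_min rho1_gt0.
have r1 : r <= rho1 by rewrite ge_min lexx.
have r2 : r <= rho - s by rewrite ge_min lexx orbT.
have cr (z : R) : `|z| < r -> cvgn (pseries c z) by move=> zr; apply: cc; lra.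
have dr (z : R) : `|z| < r -> cvgn (pseries d z).
  by move=> zr; apply: cvgP; apply: dS; lra.
have Sd y : `|y - s| < r -> limn (pseries a y) = limn (pseries d (y - s)).
  move=> yr; apply/esym/cvg_lim => //.
  by rewrite -[in X in _ --> X](subrKC s y); apply: dS; lra.
(* [gS] stops short of [s]; both sides are continuous from the left at [s], [g] through its
   expansion [c]. *)
have gs : g s = limn (pseries a s).
  have cS : limn (pseries a y) @[y --> s^'-] --> limn (pseries a s).
    apply: cvg_at_left_filter; apply: (continuous_pseries caz).
    by rewrite ger0_norm//; lra.
  have cG : limn (pseries c (y - s)) @[y --> s^'-] --> g s.
    apply: cvg_at_left_filter.
    rewrite gc // ?subrr ?normr0//.
    have ys : (y - s) @[y --> s] --> (0 : R).
      by rewrite -(subrr s); apply: cvgB; [exact: cvg_id|exact: cvg_cst].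
    have c0 : {for (0 : R), continuous (fun t => limn (pseries c t))}.
      by apply: (continuous_pseries cc); rewrite normr0.
    exact: (cvg_comp _ _ ys c0).
  suff cG' : limn (pseries a y) @[y --> s^'-] --> g s.
    by apply: (cvg_unique _ cG' cS).
  move: cG; apply: cvg_trans; apply: near_eq_cvg.
  near=> y.
  have ys : y < s by near: y; exact: nbhs_left_lt.
  (* The minimum keeps [y] both nonnegative and within [r] of [s]. *)
  have yr : s - Num.min r s < y.
    by near: y; apply: nbhs_left_gt; rewrite ltrBlDr ltrDl lt_min r_gt0.
  have m1 : Num.min r s <= r by rewrite ge_min lexx.
  have m2 : Num.min r s <= s by rewrite ge_min lexx orbT.
  rewrite -gS; last by apply/andP; split => //; lra.
  rewrite gc//; first by rewrite /= in_itv /=; apply/andP; split; lra.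
  by rewrite distrC gtr0_norm; lra.
(* Derivatives are now taken within [[0, s]], where both expansions represent [g] near [s]. *)
have cd : c = d.
  have Dss : [set` `[0, s]] s by rewrite /= in_itv /= s0 lexx.
  apply/funext => k; apply: (@mulfI _ k`!%:R).
    by rewrite pnatr_eq0 -lt0n fact_gt0.
  have lims := limit_point_itv s_gt0.
  rewrite -(nderive_in_center r_gt0 Dss lims c g cr); last first.
    move=> y /=; rewrite in_itv /= => /andP[y0 ys] yr; apply: gc; last by lra.
    by rewrite /= in_itv /= y0 (le_trans ys).
  rewrite -(nderive_in_center r_gt0 Dss lims d g dr)//.
  move=> y /=; rewrite in_itv /= => /andP[y0 ys] yr; rewrite -Sd//.
  move: ys; rewrite le_eqVlt => /orP[/eqP->//|ys].
  by apply: gS; rewrite y0.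
exists r => // y yg yr; rewrite Sd// -cd; apply: gc; last by lra.
by rewrite /= in_itv.
Unshelve. all: by end_near.
Qed.

(** Connectedness argument: the supremum [s] of the [t] with agreement on [[0, t]] cannot lie below
    [gamma], as [identity_at_sup] would push agreement past it. *)
Lemma analytic_on_eq_pseries {R : realType} {gamma rho : R} {g : R -> R} {a : R^nat} :
  0 < gamma -> gamma < rho ->
  analytic_on `[0, gamma] g ->
  (forall k, nderive_in `[0, gamma] k g 0 = k`!%:R * a k) ->
  cvgn (pseries (fun k => `|a k|) rho) ->
  forall y, 0 <= y <= gamma -> g y = limn (pseries a y).
Proof.
move=> gamma0 grho ga gder ca.
pose E := [set t : R | 0 <= t <= gamma /\
  forall y, 0 <= y <= t -> g y = limn (pseries a y)].
have E0 : E 0.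
  split; first by rewrite lexx ltW.
  move=> y; rewrite -eq_le => /eqP <-.
  by have := gder 0%N; rewrite pseries_at0 fact0 mul1r.
have Eub : ubound E gamma by move=> t [/andP[]].
have supE : has_sup E by split; [exists 0|exists gamma].
pose s := sup E.
have s0 : 0 <= s by apply: ub_le_sup => //; exists gamma.
have sg : s <= gamma by apply: ge_sup => //; exists 0.
have gS y : 0 <= y < s -> g y = limn (pseries a y).
  move=> /andP[y0 ys]; have [t [_ Et] yt] := sup_gt (ex_intro _ _ E0 : E !=set0) ys.
  by apply: Et; rewrite y0 ltW.
have [|r r0 gr] := identity_at_sup gamma0 grho _ ga gder ca gS; first by rewrite s0.
(* [t] lies in [E], so [t <= s < s + r / 2], which forces [t = gamma]. *)
pose t := Num.min gamma (s + r / 2).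
have Et : E t.
  have t1 : t <= gamma by rewrite ge_min lexx.
  have t2 : t <= s + r / 2 by rewrite ge_min lexx orbT.
  split; first by rewrite t1 le_min ltW//= addr_ge0// divr_ge0// ltW.
  move=> y /andP[y0 yt]; have [ys|sy] := ltP y s; first by apply: gS; rewrite y0.
  apply: gr; first by rewrite y0 (le_trans yt).
  by rewrite ger0_norm; lra.
have ts : t <= s by apply: ub_le_sup => //; exists gamma.
have tg : t = gamma by move: ts; rewrite /t; case: (leP gamma) => // _; lra.
by move=> y; rewrite -tg; apply: Et.2.
Qed.

(** * Geometric decay, and derivatives of monomials *)

Lemma geometric_bound_of_ratio {R : realFieldType} {f : nat -> R} {delta : R} {k0 : nat} :
  0 < delta -> (forall k, 0 <= f k) ->
  (forall k, (k0 <= k)%N -> f k.+1 <= delta * f k) ->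
  exists C, forall k, f k <= C * delta ^+ k.
Proof.
move=> d0 f0 fd; have dk k : 0 < delta ^+ k by rewrite exprn_gt0.
(* This sum of nonnegative terms dominates every [f i / delta^i] with [i <= k0]; the ratio condition
   propagates the bound beyond [k0]. *)
exists (\sum_(i < k0.+1) f i / delta ^+ i) => k.
have small i : (i <= k0)%N ->
    f i <= (\sum_(i < k0.+1) f i / delta ^+ i) * delta ^+ i.
  rewrite -ltnS => ik; rewrite -ler_pdivrMr// (bigD1 (Ordinal ik)) //= lerDl.
  by apply: sumr_ge0 => j _; rewrite divr_ge0// ltW.
elim: k => [|k IH]; first exact: small.
have [kk0|k0k] := ltnP k k0; first exact: small.
apply: le_trans (fd _ k0k) _.
by rewrite exprS mulrCA ler_pM2l.
Qed.

Lemma cvg_pseries_finite {R : realType} (c : R^nat) (N : nat) (z : R) :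
  (forall k, (N <= k)%N -> c k = 0) ->
  pseries c z @ \oo --> \sum_(0 <= k < N) c k * z ^+ k.
Proof.
move=> c0; apply: cvg_near_cst.
exists N => // M /= NM; rewrite /pseries /series /= (big_cat_nat (n := N)) //=.
rewrite [X in _ + X]big_nat_cond [X in _ + X]big1 ?addr0// => k /andP[/andP[Nk _] _].
by rewrite c0// mul0r.
Qed.

Lemma cvg_pseries_monomial {R : realType} (c : R^nat) (i : nat) (z : R) :
  (forall k, k != i -> c k = 0) -> pseries c z @ \oo --> c i * z ^+ i.
Proof.
move=> c0.
have := @cvg_pseries_finite _ c i.+1 z.
rewrite big_nat_recr //= big_nat_cond big1 ?add0r.
  by apply => k ik; rewrite c0// gtn_eqF.
by move=> k /andP[/andP[_ ki] _]; rewrite c0 ?mul0r// ltn_eqF.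
Qed.

(** A monomial is a power series with a single nonzero coefficient, convergent everywhere, so
    [nderive_in_pseries] applies on any disc containing [t]. *)
Lemma nderive_in_monomial {R : realType} {D : set R} :
  (forall y, D y -> limit_point D y) ->
  forall (x : R) (i l : nat) (t : R), D t ->
  nderive_in D l (fun t => t ^+ (i + l) * x) t = ((i + l) ^_ l)%:R * x * t ^+ i.
Proof.
move=> limD x i l t Dt; pose c k := if k == (i + l)%N then x else 0.
have c0 k : k != (i + l)%N -> c k = 0 by rewrite /c => /negbTE ->.
have cE z := cvg_pseries_monomial c (i + l) z c0.
have cil : c (i + l)%N = x by rewrite /c eqxx.
have t1 : `|t - 0| < `|t| + 1 by rewrite subr0 ltrDl.
have [|y _ _|-> _ _] // :=
  nderive_in_pseries limD c (fun t => t ^+ (i + l) * x) _ _ l t Dt t1.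
- by move=> z _; apply: cvgP; exact: cE.
- by rewrite subr0 (cvg_lim (@Rhausdorff R) (cE y)) cil mulrC.
rewrite subr0; apply: cvg_lim => //.
have := cvg_pseries_monomial (iter l (@pseries_diffs R) c) i t.
rewrite iter_pseries_diffsE cil; apply => k ki.
by rewrite iter_pseries_diffsE c0 ?mulr0// eqn_add2r.
Qed.

(** * The space [C^n(D)] and its norm *)

Lemma is_Cn_pseries {R : realType} {p : nat} {D : set R} {rho : R}
    (n : nat) (c : 'I_p -> R^nat) (h : R -> 'cV[R]_p) :
  (forall y, D y -> limit_point D y) -> (forall y, D y -> `|y| < rho) ->
  (forall j z, `|z| < rho -> cvgn (pseries (c j) z)) ->
  (forall j y, D y -> component h j y = limn (pseries (c j) y)) ->
  is_Cn D n h.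
Proof.
move=> limD Drho cc hE.
have hE0 j y : D y -> `|y - 0| < rho -> component h j y = limn (pseries (c j) (y - 0)).
  by rewrite subr0 => Dy _; exact: hE.
have H j k y (Dy : D y) := nderive_in_pseries limD (c j) (component h j) (cc j) (hE0 j) k y Dy.
split.
  by move=> j k _ y Dy; have [|_ ? _] := H j k y Dy; rewrite ?subr0 ?Drho.
move=> j k _; apply/subspace_continuousP => y Dy.
by have [|_ _ ?] := H j k y Dy; rewrite ?subr0 ?Drho.
Qed.

Lemma Cn_norm_ge0 {R : realType} {p : nat} (D : set R) (n : nat) (h : R -> 'cV[R]_p) :
  0 <= Cn_norm D n h.
Proof. exact: bigmax_ge_id. Qed.

Lemma Cn_norm_le {R : realType} {p : nat} {D : set R} {n : nat} {h : R -> 'cV[R]_p} {M : R} :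
  D !=set0 -> 0 <= M ->
  (forall j l t, (l <= n)%N -> D t -> `|nderive_in D l (component h j) t| <= M) ->
  Cn_norm D n h <= M.
Proof.
move=> [t0 Dt0] M0 hM; apply: bigmax_le => // j _; apply: bigmax_le => // l _.
apply: ge_sup; first by eexists; exists t0.
by move=> _ [t Dt <-]; apply: hM; rewrite // -ltnS.
Qed.

(** The supremum of a set without upper bound is a default value, hence the boundedness
    hypothesis. *)
Lemma le_Cn_norm {R : realType} {p : nat} {D : set R} {n : nat} {h : R -> 'cV[R]_p}
    {j : 'I_p} {l : nat} {t : R} :
  (l <= n)%N -> D t ->
  has_ubound [set `|nderive_in D l (component h j) t| | t in D] ->
  `|nderive_in D l (component h j) t| <= Cn_norm D n h.
Proof.
move=> ln Dt ub; apply: (@le_trans _ _ (sup [set `|nderive_in D l (component h j) t| | t in D])).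
  by apply: ub_le_sup => //; exists t.
rewrite /Cn_norm; apply: le_trans (le_bigmax _ _ j).
exact: (le_bigmax 0 (fun l : 'I_n.+1 =>
  sup [set `|nderive_in D l (component h j) t| | t in D]) (Ordinal (ln : (l < n.+1)%N))).
Qed.

(** The left side is the absolute value at [gamma] of the [l]-th derivative of the term of degree
    [i + l], that is, of the [i]-th term of the [l]-th derived series. *)
Lemma dtm_coef_le {R : realType} {n p : nat} {gamma : R} {u : R -> 'cV[R]_p}
    (j : 'I_p) (i l : nat) :
  0 < gamma -> (l <= n)%N ->
  `|((i + l) ^_ l)%:R * dtm `[0, gamma] u (i + l) j 0| * gamma ^+ i <=
  Cn_norm `[0, gamma] n (dtm_term `[0, gamma] u (i + l)).
Proof.
move=> g0 ln; have limD := limit_point_itv g0.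
have Dg : [set` `[0, gamma]] gamma by rewrite /= in_itv /= lexx ltW.
have H t : [set` `[0, gamma]] t ->
    nderive_in `[0, gamma] l (component (dtm_term `[0, gamma] u (i + l)) j) t =
    ((i + l) ^_ l)%:R * dtm `[0, gamma] u (i + l) j 0 * t ^+ i.
  move=> Dt; rewrite -(nderive_in_monomial limD)//; congr nderive_in.
  by apply/funext => y; rewrite /component /dtm_term mxE.
have E t : [set` `[0, gamma]] t ->
    `|nderive_in `[0, gamma] l (component (dtm_term `[0, gamma] u (i + l)) j) t| =
    `|((i + l) ^_ l)%:R * dtm `[0, gamma] u (i + l) j 0| * t ^+ i.
  move=> Dt; rewrite H// normrM normrX (@ger0_norm _ t)//.
  by move: Dt; rewrite /= in_itv /= => /andP[].
rewrite -E//; apply: le_Cn_norm => //.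
exists (`|((i + l) ^_ l)%:R * dtm `[0, gamma] u (i + l) j 0| * gamma ^+ i).
move=> _ [t Dt <-]; rewrite E//; move: Dt; rewrite /= in_itv /= => /andP[t0 tg].
by rewrite ler_wpM2l// lerXn2r// nnegrE ltW.
Qed.

(** * Convergence of the transformed series in [C^n(J)] *)

Lemma dtm_series_Cn_cvg {R : realType} {n p : nat} {gamma : R} {u : R -> 'cV[R]_p}
    {delta : R} {k0 : nat} :
  0 < gamma -> (forall j : 'I_p, analytic_on `[0, gamma] (component u j)) ->
  0 < delta < 1 ->
  (forall k, (k0 <= k)%N ->
     Cn_norm `[0, gamma] n (dtm_term `[0, gamma] u k.+1) <=
     delta * Cn_norm `[0, gamma] n (dtm_term `[0, gamma] u k)) ->
  Cn_series_cvg `[0, gamma] n (dtm_term `[0, gamma] u) u.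
Proof.
move=> g0 ua /andP[d0 d1] ratio.
have limD := limit_point_itv g0.
pose a (j : 'I_p) k := dtm `[0, gamma] u k j 0.
have aE j k : nderive_in `[0, gamma] k (component u j) 0 = k`!%:R * a j k.
  by rewrite /a /dtm /vderive_in !mxE mulVKf// pnatr_eq0 -lt0n fact_gt0.
have [C FC] := geometric_bound_of_ratio d0 (fun k => Cn_norm_ge0 _ _ _) ratio.
have C0 : 0 <= C by have := FC 0%N; rewrite expr0 mulr1; apply: le_trans; exact: Cn_norm_ge0.
(* Serves with [l = 0] for convergence at [rho], and with every [l <= n] for the remainders. *)
have coef_le j i l : (l <= n)%N ->
    `|((i + l) ^_ l)%:R * a j (i + l)%N| * gamma ^+ i <= C * delta ^+ (i + l).
  by move=> ln; apply: le_trans (FC (i + l)%N); exact: dtm_coef_le.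
(* [rho < gamma / delta] makes the ratio [delta * rho / gamma] of the dominating geometric series
   less than 1. *)
have [|rho /andP[grho rhog]] := @exists_between _ gamma (gamma / delta).
  by rewrite ltr_pdivlMr// gtr_pMr.
have rho0 : 0 < rho by exact: lt_trans grho.
have ca j : cvgn (pseries (fun k => `|a j k|) rho).
  apply: (@is_cvg_series_dominated _ _ (geometric C (delta * rho / gamma))).
    move=> k; rewrite /= normrM normr_id normrX gtr0_norm//.
    have := coef_le j k 0%N (leq0n n); rewrite addn0 ffactn0 mul1r.
    rewrite -ler_pdivlMr ?exprn_gt0// => h.
    apply: le_trans (ler_wpM2r _ h) _; first by rewrite exprn_ge0// ltW.
    by rewrite expr_div_n exprMn le_eqVlt; apply/orP; left; apply/eqP; ring.
  apply: is_cvg_geometric_series.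
  rewrite ger0_norm; last by rewrite divr_ge0 ?mulr_ge0// ltW.
  by rewrite ltr_pdivrMr// mul1r mulrC -ltr_pdivlMr.
have caz j (z : R) : `|z| < rho -> cvgn (pseries (a j) z).
  move=> zr; apply: (is_cvg_series_dominated _ (ca j)) => k.
  by rewrite normrM normrX ler_wpM2l// lerXn2r ?nnegrE// ltW.
have uS j y : [set` `[0, gamma]] y -> component u j y = limn (pseries (a j) y).
  rewrite /= in_itv /= => yg.
  exact: analytic_on_eq_pseries g0 grho (ua j) (aE j) (ca j) y yg.
have Drho y : [set` `[0, gamma]] y -> `|y| < rho.
  by rewrite /= in_itv /= => /andP[y0 yg]; rewrite ger0_norm// (le_lt_trans yg).
split.
- move=> k; pose c (j : 'I_p) i := if i == k then a j k else 0.
  have cE j z : pseries (c j) z @ \oo --> c j k * z ^+ k.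
    by apply: cvg_pseries_monomial => i ik; rewrite /c (negbTE ik).
  apply: (is_Cn_pseries n c _ limD Drho) => [j z _|j y _].
    by apply: cvgP; exact: cE.
  by rewrite (cvg_lim (@Rhausdorff R) (cE j y)) /c eqxx /component /dtm_term mxE mulrC.
- exact: (is_Cn_pseries n a _ limD Drho).
(* The [l]-th derivative of the [N]-th remainder has no terms of degree below
   [N - l], whence the index [N - n] in [tail]. *)
pose g := geometric C delta.
have cg : cvgn (series g) by apply: is_cvg_geometric_series; rewrite gtr0_norm.
have tail N : Cn_norm `[0, gamma] n
    (fun t => \sum_(k < N) dtm_term `[0, gamma] u k t - u t) <=
    limn (series g) - series g (N - n)%N.
  have D0 : [set` `[0, gamma]] 0 by rewrite /= in_itv /= lexx ltW.
  apply: Cn_norm_le; first by exists 0.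
    rewrite subr_ge0; apply: nondecreasing_cvgn_le => //.
    apply/nondecreasing_seqP => k; rewrite /series /= big_nat_recr //= lerDl.
    by rewrite mulr_ge0// exprn_ge0// ltW.
  move=> j l t ln Dt.
  (* [b] is [a j] truncated at [N], so [c] holds the coefficients of the remainder: 0 below [N] and
     [- a j k] from [N] on. *)
  pose b k := if (k < N)%N then a j k else 0.
  pose c k := b k - a j k.
  have bE z : pseries b z @ \oo --> \sum_(0 <= k < N) b k * z ^+ k.
    by apply: cvg_pseries_finite => k; rewrite /b ltnNge => ->.
  have cE z : `|z| < rho ->
      pseries c z @ \oo --> \sum_(0 <= k < N) b k * z ^+ k - limn (pseries (a j) z).
    move=> zr; have -> : pseries c z = (fun M => pseries b z M - pseries (a j) z M).
      apply/funext => M; rewrite /pseries /series /= -sumrB.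
      by apply: eq_bigr => k _; rewrite mulrBl.
    by apply: cvgB => //; exact: caz.
  have t0rho : `|t - 0| < rho by rewrite subr0; exact: Drho.
  have [|y Dy yr|-> _ _] := nderive_in_pseries limD c
    (component (fun t => \sum_(k < N) dtm_term `[0, gamma] u k t - u t) j) _ _ l t Dt t0rho.
  - by move=> z zr; apply: cvgP; exact: cE.
  - rewrite subr0 in yr *; rewrite (cvg_lim (@Rhausdorff R) (cE y yr)) -uS//.
    rewrite /component !mxE; congr (_ - _); rewrite summxE big_mkord.
    by apply: eq_bigr => k _; rewrite /b ltn_ord /dtm_term mxE mulrC.
  rewrite subr0; move: (Dt); rewrite /= in_itv /= => /andP[t0 tg].
  pose v i := iter l (@pseries_diffs R) c i * t ^+ i.
  have vg i : `|v i| <= g i.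
    rewrite /v iter_pseries_diffsE /c /b normrM normrX (ger0_norm t0).
    case: ifP => _; first by rewrite subrr mulr0 normr0 mul0r mulr_ge0// exprn_ge0// ltW.
    rewrite sub0r mulrN normrN.
    (* Replacing [t] by [gamma] reaches [coef_le]; then [delta^l <= 1] is dropped, so that one
       geometric series serves all [l <= n]. *)
    apply: (@le_trans _ _ (C * delta ^+ (i + l))).
      apply: le_trans (coef_le j i l ln).
      by rewrite ler_wpM2l// lerXn2r// nnegrE ltW.
    by rewrite ler_wpM2l// exprD ler_piMr ?exprn_ge0 ?exprn_ile1// ltW.
  have -> : limn (pseries (iter l (@pseries_diffs R) c) t) =
      limn (series v) - series v (N - n)%N.
    rewrite [X in _ - X](_ : _ = 0) ?subr0// /series /= big_nat_cond big1// => i.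
    move=> /andP[/andP[_ iN] _]; rewrite /v iter_pseries_diffsE /c /b.
    have -> : (i + l < N)%N by rewrite (leq_ltn_trans (leq_add (leqnn i) ln))// addnC -ltn_subRL.
    by rewrite subrr mulr0 mul0r.
  exact: series_tail_le.
have lim0 : limn (series g) - series g (N - n)%N @[N --> \oo] --> (0 : R).
  rewrite -(subrr (limn (series g))); apply: cvgB; first exact: cvg_cst.
  (* Shifting by [n] turns the truncated index [N - n] into [N]. *)
  rewrite -(cvg_shiftn n) /=.
  rewrite (_ : (fun N => _) = series g)//.
  by apply/funext => N; rewrite addnK.
apply: (squeeze_cvgr _ (cvg_cst 0) lim0).
by apply: nearW => N; rewrite Cn_norm_ge0 tail.
Qed.

Theorem theorem1 (R : realType) (n p r : nat) (m : 'I_r -> nat)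
  (hn : (0 < n)%N) (hp : (0 < p)%N) (hr : (0 < r)%N)
  (hm : forall i, (m i <= n)%N)
  (f : 'rV[R]_(argdim n p m) -> 'cV[R]_p)
  (hf : forall j : 'I_p,
     {within [set x | 0 <= time_coord x], continuous (fun x => f x j 0)})
  (alpha : 'I_r -> R -> R) (halpha : forall i, is_delay (alpha i))
  (v : 'I_n -> 'cV[R]_p) (Phi : R -> 'cV[R]_p)
  (hPhi : (tstar alpha < 0)%E ->
     is_Cn (past alpha) n Phi /\
     forall k : 'I_n, vderive_in (past alpha) k Phi 0 = v k)
  (T : R) (hT : 0 < T)
  (hanalytic : forall j : 'I_p,
     multi_analytic_on [set x | 0 <= time_coord x <= T] (fun x => f x j 0))
  (u : R -> 'cV[R]_p)
  (hsol : is_solution f alpha v Phi T u)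
  (huniq : forall w, is_solution f alpha v Phi T w ->
     forall t : R, 0 <= t <= T -> w t = u t)
  (gamma : R) (hgamma : 0 < gamma <= T)
  (hu : forall j : 'I_p, analytic_on `[0, gamma] (component u j))
  (hratio : exists (delta : R) (k0 : nat), 0 < delta < 1 /\
     forall k, (k0 <= k)%N ->
       Cn_norm `[0, gamma] n (dtm_term `[0, gamma] u k.+1) <=
       delta * Cn_norm `[0, gamma] n (dtm_term `[0, gamma] u k)) :
  Cn_series_cvg `[0, gamma] n (dtm_term `[0, gamma] u) u.
Proof.
have /andP[gamma0 _] := hgamma.
have [delta [k0 [hdelta ratio]]] := hratio.
exact: dtm_series_Cn_cvg gamma0 hu hdelta ratio.
Qed.
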